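(* There is an absolute constant $C>0$ such that for all positive integers $n$ and $t\ge2$ and all $\pi,\tau\in S_n$ with $d(\pi,\tau)=t$, \[\Delta(\lambda(\pi),\lambda(\tau))\le C\sqrt{n\,t\ln t}.\]
   Context: Permutations are written in one-line notation. For $\pi\in S_n$, $\lambda(\pi)$ denotes the shape of the tableaux associated with $\pi$ by the RSK correspondence. The distance $d(\pi,\tau)$ is the least number of adjacent transpositions $(k,k+1)$, $1\le k\le n-1$, whose successive left multiplication transforms $\pi$ into $\tau$. For partitions $\lambda,\mu$ of $n$ (parts padded with zeros), $\Delta(\lambda,\mu)=\frac12\sum_{i=1}^n|\lambda_i-\mu_i|$. *)

(* Defs.v *)
From Stdlib Require Import Reals.
From mathcomp Require Import all_boot all_fingroup.
Set Implicit Arguments. Unset Strict Implicit. Unset Printing Implicit Defensive.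

Fixpoint row_ins (x : nat) (r : seq nat) : option nat * seq nat :=
  match r with
  | [::] => (None, [:: x])
  | y :: r' => if (x < y)%N then (Some y, x :: r')
               else let: (b, r'') := row_ins x r' in (b, y :: r'')
  end.

Fixpoint rsk_ins (x : nat) (T : seq (seq nat)) : seq (seq nat) :=
  match T with
  | [::] => [:: [:: x]]
  | r :: T' => let: (b, r') := row_ins x r in
               match b with
               | None => r' :: T'
               | Some y => r' :: rsk_ins y T'
               end
  end.

(* One-line notation of pi : 'S_n (values 0..n-1 instead of 1..n; the RSK
   shape only depends on relative order). *)
Definition one_line n (p : 'S_n) : seq nat := [seq val (p i) | i <- enum 'I_n].

Definition rsk_P n (p : 'S_n) : seq (seq nat) :=
  foldl (fun T x => rsk_ins x T) [::] (one_line p).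
Definition rsk_shape n (p : 'S_n) : seq nat := map size (rsk_P p).

(* Left multiplication of p by the transposition (k, k+1) of values:
   (s_k o p)(i) = s_k (p i).  In MathComp, (p * s)%g x = s (p x). *)
Definition adj_left n (k : nat) (p : 'S_n) : 'S_n :=
  match @insub nat (fun i => i < n)%N 'I_n k, @insub nat (fun i => i < n)%N 'I_n k.+1 with
  | Some a, Some b => (p * tperm a b)%g
  | _, _ => p
  end.

(* Valid adjacent transposition index: 0-based k with k+1 < n
   (i.e. 1 <= k <= n-1 in 1-based notation). *)
Definition reach_in n (m : nat) (p q : 'S_n) : Prop :=
  exists ks : seq nat, size ks = m /\ all (fun k : nat => (k.+1 < n)%N) ks /\
    foldl (fun r k => adj_left k r) p ks = q.

Definition perm_dist_is n (p q : 'S_n) (t : nat) : Prop :=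
  reach_in t p q /\ forall m, reach_in m p q -> (t <= m)%N.

Definition Delta_shape (n : nat) (la mu : seq nat) : R :=
  Rmult (Rinv 2)
    (foldr Rplus R0 [seq Rabs (Rminus (INR (nth 0 la i)) (INR (nth 0 mu i))) | i <- iota 0 n]).

(* Main.v *)
(* By Greene's theorem, the sum of the first k rows of the shape of w is the
   largest number of letters covered by k disjoint increasing subsequences of w.
   Exchanging the values a and a + 1 spoils at most one of these subsequences,
   which deleting one letter repairs; so if d(pi, tau) = t and la, mu are the two
   shapes, all partial row sums of la and mu differ by at most t.  Put
   f_i = max(la_i - mu_i, 0).  Differences of partial sums give f_i <= 2t, and
   also that f sums to at most 2t over the rows meeting the set la \ mu in a
   given column c, rows which form an interval ending at row la'_c.  Summing
   i f_i^2 by columns, sum_i i f_i^2 <= sum_c 2t la'_c = 2tn.  Finally sum_i f_i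
   is bounded by f_i <= 2t when i^2 t <= n, by f_i <= i f_i^2 / sqrt(nt) when
   i^2 > nt, and in between by AM-GM against 1/i, whose sum there is at most
   1 + ln t. *)
Require Import Defs.
From Stdlib Require Import Reals Lra.
From mathcomp Require Import all_boot all_fingroup.
From mathcomp Require Import zify.
Set Implicit Arguments. Unset Strict Implicit. Unset Printing Implicit Defensive.

(** * Covers by disjoint increasing subsequences and the Knuth relations *)

Definition incr_rel k (c : nat -> nat) : rel nat :=
  fun x y => (c x == c y) && (c x < k) ==> (x < y).

(* k disjoint increasing subsequences are encoded by a colouring c of the letters:
   the colours below k are the subsequences, the other letters are not selected. *)
Definition incr_cover k (w : seq nat) m :=
  exists2 c, pairwise (incr_rel k c) w & m <= count (fun x => c x < k) w.

Lemma incr_relP k c x y :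
  reflect (c x = c y -> c x < k -> x < y) (incr_rel k c x y).
Proof.
apply: (iffP implyP) => H; first by move=> e l; apply: H; rewrite e eqxx -e.
by case/andP=> /eqP; exact: H.
Qed.

Lemma eq_in_pairwise (T : eqType) (r r' : rel T) s :
  {in s &, r =2 r'} -> pairwise r s = pairwise r' s.
Proof.
by move=> H; apply/idP/idP; apply: (@sub_in_pairwise _ (mem s)); rewrite ?all_predT;
  try (by apply/allP); move=> a b ha hb; rewrite H.
Qed.

Lemma pairwise_cat_mem (T : eqType) (r : rel T) p q a b :
  pairwise r (p ++ q) -> a \in p -> b \in q -> r a b.
Proof. by rewrite pairwise_cat => /and3P[/allrelP H _ _] /H; apply. Qed.

Definition swap_col (j j' i : nat) := if i == j then j' else if i == j' then j else i.

(** Two subsequences exchange their tails at the cut between [p] and [q]. Inside [p] and inside [q]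
    equality of colours is preserved; the two order hypotheses are what the newly joined pairs
    across the cut need. *)
Lemma incr_swap_tail k c j j' p q :
    uniq (p ++ q) -> pairwise (incr_rel k c) (p ++ q) -> j < k -> j' < k ->
    (forall a b, a \in p -> b \in q -> c a = j -> c b = j' -> a < b) ->
    (forall a b, a \in p -> b \in q -> c a = j' -> c b = j -> a < b) ->
  let c' := fun x => if x \in q then swap_col j j' (c x) else c x in
  pairwise (incr_rel k c') (p ++ q) /\
  count (fun x => c' x < k) (p ++ q) = count (fun x => c x < k) (p ++ q).
Proof.
move=> Uw Gw jk j'k H1 H2 c'.
have pq a : a \in p -> a \in q = false.
  by move: Uw; rewrite cat_uniq => /and3P[_ /hasPn H _] ap; apply/negP=> /H; rewrite /= ap.
have swk i : (swap_col j j' i < k) = (i < k).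
  by rewrite /swap_col; case: eqP => [->|_]; [rewrite jk | case: eqP => // ->; rewrite jk].
split; last first.
  by apply: eq_count => x; rewrite /c'; case: ifP => // _; rewrite swk.
move: Gw; rewrite !pairwise_cat => /and3P[Gpq Gp Gq]; apply/and3P; split.
- apply/allrelP=> a b ap bq; apply/incr_relP; rewrite /c' (pq a ap) bq /swap_col.
  case: eqP => [cb ca|nj]; first by move=> _; apply: H2.
  case: eqP => [cb ca|nj' ca ck]; first by move=> _; apply: H1.
  by move/allrelP: Gpq => /(_ a b ap bq) /incr_relP; apply.
- rewrite (@eq_in_pairwise _ _ (incr_rel k c)) // => a b ap bp.
  by rewrite /incr_rel /c' !pq.
- rewrite (@eq_in_pairwise _ _ (incr_rel k c)) // => a b ap bp.
  rewrite /incr_rel /c' ap bp swk; congr (_ && _ ==> _).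
  rewrite /swap_col; by do !case: eqP => //; lia.
Qed.

Lemma pairwise_transpose (T : eqType) (r : rel T) u x y v :
  r y x -> pairwise r (u ++ x :: y :: v) -> pairwise r (u ++ y :: x :: v).
Proof.
move=> ryx; rewrite !pairwise_cat /= !allrel_consr.
by move=> /and3P[/and3P[-> -> ->] -> /andP[/andP[_ ->] /andP[-> ->]]]; rewrite ryx.
Qed.

Lemma count_transpose (T : eqType) (r : pred T) u x y v :
  count r (u ++ x :: y :: v) = count r (u ++ y :: x :: v).
Proof. by rewrite !count_cat /=; lia. Qed.

(** Removing an inversion breaks no increasing subsequence, so the same colouring serves. *)
Lemma incr_cover_transpose k u x y v m :
  x < y -> incr_cover k (u ++ y :: x :: v) m -> incr_cover k (u ++ x :: y :: v) m.
Proof.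
move=> xy [c G cm]; exists c; last by rewrite count_transpose.
by apply: pairwise_transpose => //; apply/incr_relP.
Qed.

Lemma incr_cover_transpose_distinct k c u x y v m :
    ~~ ((c x == c y) && (c x < k)) ->
    pairwise (incr_rel k c) (u ++ x :: y :: v) ->
    m <= count (fun x => c x < k) (u ++ x :: y :: v) ->
  incr_cover k (u ++ y :: x :: v) m.
Proof.
move=> H G cm; exists c; last by rewrite count_transpose.
apply: pairwise_transpose => //; apply/incr_relP=> e l.
by move: H; rewrite -e eqxx l.
Qed.

(* If x and z have the same colour, y has another one, j'.  When j' < k, exchange
   the two colours from z onwards; otherwise y replaces x in its subsequence.
   This separates x from z, which can then be transposed. *)
Lemma incr_cover_yxz k u v x y z m :
    x < y -> y < z -> uniq (u ++ [:: y, x, z & v]) ->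
  incr_cover k (u ++ [:: y, x, z & v]) m -> incr_cover k (u ++ [:: y, z, x & v]) m.
Proof.
move=> xy yz U [c G cm].
have E (a b : nat) : u ++ [:: y, a, b & v] = rcons u y ++ [:: a, b & v].
  by rewrite cat_rcons.
case: (boolP ((c x == c z) && (c x < k))) => [/andP[/eqP exz xk]|H]; last first.
  by rewrite E; apply: (incr_cover_transpose_distinct H); rewrite -E.
have := G; rewrite pairwise_cat /= !allrel_consr.
case/and3P=> /and4P[/allP Guy /allP Gux /allP Guz /allrelP Guv] Gu.
case/andP=> /and3P[/incr_relP yx _ /allP Gyv] /andP[/andP[/incr_relP _ /allP Gxv] /andP[/allP Gzv Gv]].
have nyx : c y <> c x by move=> e; move: (yx e); rewrite e => /(_ xk); rewrite ltnNge (ltnW xy).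
have := U; rewrite cat_uniq /= !inE !negb_or => /and3P[Uu /and4P[yu xu zu /hasPn Huv]].
case/and4P=> /and3P[nyx' nyz yv] /andP[nxz xv] zv Uv.
case: (ltnP (c y) k) => yk.
- have E2 : u ++ [:: y, x, z & v] = (u ++ [:: y; x]) ++ z :: v by rewrite -catA.
  have := G; rewrite E2 => G2.
  (* The cut lies between x and z. Earlier letters of colour [c x] are at most x < y, hence below
     the later letters of colour [c y]; earlier letters of colour [c y] are at most y < z, hence
     below z and the later letters of its colour. *)
  have /= := @incr_swap_tail k c (c x) (c y) _ _ _ G2 xk yk.
  rewrite -E2 => /(_ U)[a b|a b|].
  + rewrite mem_cat !inE => ha /orP[/eqP->|bv] ca cb; first by case: nyx; rewrite exz.
    have yb : y < b by move/incr_relP: (Gyv _ bv); apply.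
    case/orP: ha ca => [au ca|/orP[/eqP->|/eqP->] //]; last by rewrite (ltn_trans xy).
    have ax : a < x by move/incr_relP: (Gux _ au); apply; rewrite ?ca.
    exact: ltn_trans (ltn_trans ax xy) yb.
  + move=> ha hb ca cb.
    have yb : y < b.
      move: hb cb; rewrite inE => /orP[/eqP->|bv] cb //.
      have zb : z < b by move/incr_relP: (Gzv _ bv); apply; rewrite -exz.
      exact: ltn_trans yz zb.
    move: ha ca; rewrite mem_cat !inE => /orP[au ca|/orP[/eqP->|/eqP->] ca] //; last by case: nyx.
    have ay : a < y by move/incr_relP: (Guy _ au); apply; rewrite ?ca.
    exact: ltn_trans ay yb.
  set c' := (fun _ => _) => G' C'; rewrite E.
  apply: (@incr_cover_transpose_distinct k c'); rewrite -?E // ?C' //.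
  rewrite negb_and /c' !inE (negPf nxz) (negPf xv) eqxx /= /swap_col -exz eqxx.
  by apply/orP; left; apply/eqP => e; case: nyx.
(* Colour [k] means not selected: y enters the subsequence in place of x, so the number of selected
   letters stays the same. *)
- pose c' a := if a == y then c x else if a == x then k else c a.
  have c'y : c' y = c x by rewrite /c' eqxx.
  have c'x : c' x = k by rewrite /c' eqxx eq_sym (negPf nyx').
  have c'z : c' z = c z by rewrite /c' ![z == _]eq_sym (negPf nyz) (negPf nxz).
  have c'u : {in u, c' =1 c}.
    move=> a au; rewrite /c'; case: eqP => [e|_]; first by rewrite -e au in yu.
    by case: eqP => // e; rewrite -e au in xu.
  have c'v : {in v, c' =1 c}.
    move=> a au; rewrite /c'; case: eqP => [e|_]; first by rewrite -e au in yv.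
    by case: eqP => // e; rewrite -e au in xv.
  rewrite E; apply: (@incr_cover_transpose_distinct k c'); rewrite -?E //.
  + by rewrite c'x ltnn andbF.
  + rewrite pairwise_cat /= !allrel_consr; apply/and3P; split.
    * apply/and4P; split; [apply/allP=> a au..|apply/allrelP=> a b au bv];
        apply/incr_relP; rewrite ?c'y ?c'x ?c'z ?(c'u _ au) //.
      - by move=> e l; apply: ltn_trans xy; move/incr_relP: (Gux _ au); apply.
      - by move=> ->; rewrite ltnn.
      - by have /incr_relP := Guz _ au.
      - by rewrite (c'v _ bv); move/incr_relP: (Guv _ _ au bv).
    * by rewrite (@eq_in_pairwise _ _ (incr_rel k c)) // => a b au bu; rewrite /incr_rel !c'u.
    * rewrite (@eq_in_pairwise _ (incr_rel k c') (incr_rel k c)) ?Gv; last first.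
        by move=> a b au bu; rewrite /incr_rel !c'v.
      rewrite andbT; apply/and3P; split; [apply/and3P; split|apply/andP; split|];
        try apply/allP=> a av; apply/incr_relP; rewrite ?c'y ?c'x ?c'z ?c'v ?ltnn //.
      - by move=> e; rewrite e ltnn in xk.
      - by move=> e l; apply: ltn_trans yz _; move/incr_relP: (Gzv _ av); apply; rewrite -?exz.
      - by move/incr_relP: (Gzv _ av).
  + apply: (leq_trans cm); rewrite !count_cat /= c'y c'x c'z.
    rewrite (@eq_in_count _ _ (fun x => c' x < k) u); last by move=> a /c'u /= ->.
    rewrite (@eq_in_count _ _ (fun x => c' x < k) v); last by move=> a /c'v /= ->.
    by rewrite ltnn ltnNge yk !add0n /= !addnA [_ + (c x < k)]addnC.
Qed.

Lemma pairwise_rev (T : Type) (r : rel T) s :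
  pairwise r (rev s) = pairwise (fun x y => r y x) s.
Proof. by elim: s => //= x s IH; rewrite rev_cons pairwise_rcons all_rev IH. Qed.

(** Reversal and complement each turn increasing into decreasing, so together they preserve
    increasing subsequences. The bound [N] on the letters keeps the truncated subtraction
    invertible. *)
Lemma incr_cover_rev k N w m :
  all (leq^~ N) w -> incr_cover k w m -> incr_cover k (rev [seq N - x | x <- w]) m.
Proof.
move=> /allP wN [c G cm]; exists (fun x => c (N - x)).
- rewrite pairwise_rev pairwise_map.
  apply: (@sub_in_pairwise _ (mem w) _ _ _ _ _ G); last exact/allP.
  move=> a b aw bw /= /incr_relP H; apply/incr_relP.
  rewrite /= !subKn; [|exact: wN..] => e l.
  have lt : a < b by apply: H; rewrite -?e.
  by have aN := wN _ aw; have bN := wN _ bw; clear -lt aN bN; lia.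
- rewrite count_rev count_map (@eq_in_count _ _ (fun x => c x < k)) // => a aw.
  by rewrite /= subKn //; exact: wN.
Qed.

Lemma rev_complement_involutive N w :
  all (leq^~ N) w -> rev [seq N - x | x <- rev [seq N - x | x <- w]] = w.
Proof.
move=> /allP wN; rewrite map_rev revK -map_comp -[RHS]map_id.
by apply/eq_in_map => x xw; rewrite /= subKn //; exact: wN.
Qed.

(* Reversing the word and the order of the letters exchanges the two Knuth relations. *)
Lemma incr_cover_xzy k u v x y z m :
    x < y -> y < z -> uniq (u ++ [:: x, z, y & v]) ->
  incr_cover k (u ++ [:: x, z, y & v]) m -> incr_cover k (u ++ [:: z, x, y & v]) m.
Proof.
(* Any upper bound on the letters would do; their sum is one. *)
move=> xy yz U G; pose N := sumn (u ++ [:: x, z, y & v]).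
have wN : all (leq^~ N) (u ++ [:: x, z, y & v]).
  rewrite /N; apply/allP=> a; elim: (u ++ _) => //= b s IH.
  by rewrite inE => /orP[/eqP->|/IH h]; rewrite ?leq_addr ?(leq_trans h) ?leq_addl.
have wN' : all (leq^~ N) (u ++ [:: z, x, y & v]).
  by move: wN; rewrite !all_cat /= => /and5P[-> -> -> ->].
have /and5P[_ xN zN yN _] : [&& all (leq^~ N) u, x <= N, z <= N, y <= N & all (leq^~ N) v].
  by move: wN; rewrite all_cat.
rewrite -(rev_complement_involutive wN'); apply: incr_cover_rev.
  by rewrite all_rev all_map; apply/allP=> a _ /=; exact: leq_subr.
have := incr_cover_rev wN G.
rewrite !map_cat !rev_cat /= !rev_cons -!cats1 -!catA /=; apply: incr_cover_yxz.
- by clear -yz zN; lia.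
- by clear -xy yN; lia.
- have := U; rewrite -rev_uniq -(@map_inj_in_uniq _ _ (fun x => N - x)).
    by rewrite rev_cat !rev_cons map_cat !map_rcons -!cats1 -!catA /= !map_rev.
  move=> a b; rewrite !mem_rev => /(allP wN) aN /(allP wN) bN e.
  by clear -aN bN e; lia.
Qed.

(** One direction only removes an inversion; the other is the exchange of colours. *)
Lemma incr_cover_knuth1 k u v x y z m :
    x < y -> y < z -> uniq (u ++ [:: y, z, x & v]) ->
  incr_cover k (u ++ [:: y, z, x & v]) m <-> incr_cover k (u ++ [:: y, x, z & v]) m.
Proof.
move=> xy yz U; split.
- by rewrite -!(cat_rcons y); apply: incr_cover_transpose; exact: ltn_trans yz.
- apply: incr_cover_yxz => //; rewrite (perm_uniq (s2 := u ++ [:: y, z, x & v])) //.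
  by apply/seq.permP=> a; rewrite !count_cat /=; lia.
Qed.

Lemma incr_cover_knuth2 k u v x y z m :
    x < y -> y < z -> uniq (u ++ [:: x, z, y & v]) ->
  incr_cover k (u ++ [:: x, z, y & v]) m <-> incr_cover k (u ++ [:: z, x, y & v]) m.
Proof.
move=> xy yz U; split; first exact: incr_cover_xzy.
by apply: incr_cover_transpose; exact: ltn_trans yz.
Qed.

(** * Row insertion as a chain of Knuth relations *)

(** First half of a bump: the inserted x travels left over the entries beyond y. Each move is a
    first Knuth relation in which the left neighbour of the passed entry has the middle value. *)
Lemma incr_cover_shift_left k m u y r x v :
    path ltn y r -> x < y -> uniq (u ++ y :: r ++ x :: v) ->
  incr_cover k (u ++ y :: r ++ x :: v) m <-> incr_cover k (u ++ y :: x :: r ++ v) m.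
Proof.
elim: r u y => [|z r IH] u y //= /andP[yz pz] xy U.
have := IH (rcons u y) z pz (ltn_trans xy yz); rewrite !cat_rcons => /(_ U) ->.
apply: incr_cover_knuth1 => //.
rewrite (perm_uniq (s2 := u ++ [:: y, z & r ++ x :: v])) //.
by apply/seq.permP=> a; rewrite !count_cat /= !count_cat /=; lia.
Qed.

(** Second half of a bump: the bumped y travels left over the entries smaller than x. Each move is a
    second Knuth relation in which the right neighbour of the passed entry, finally x itself, has
    the middle value. *)
Lemma incr_cover_shift_right k m u r y x v :
    sorted ltn r -> all (ltn^~ x) r -> x < y -> uniq (u ++ r ++ y :: x :: v) ->
  incr_cover k (u ++ r ++ y :: x :: v) m <-> incr_cover k (u ++ y :: r ++ x :: v) m.
Proof.
elim: r u => [|p r IH] u //= pr /andP[px ax] xy U.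
have E : u ++ p :: r ++ [:: y, x & v] = rcons u p ++ r ++ [:: y, x & v] by rewrite cat_rcons.
rewrite E IH // -?E // ?(path_sorted pr) // cat_rcons.
have Up : uniq (u ++ [:: p, y & r ++ x :: v]).
  rewrite (perm_uniq (s2 := u ++ p :: r ++ [:: y, x & v])) //.
  by apply/seq.permP=> a; rewrite !count_cat /= !count_cat /=; lia.
case: r pr ax Up {IH E U} => [|q r] /= pr ax Up; first exact: incr_cover_knuth2.
by case/andP: pr => pq _; case/andP: ax => qx _; apply: incr_cover_knuth2 => //; exact: ltn_trans xy.
Qed.

(** * Row insertion and the tableau property *)

Lemma row_insE x r : let p := find (ltn x) r in
  row_ins x r = (if p < size r then Some (nth 0 r p) else None, set_nth 0 r p x).
Proof. by elim: r => //= y r ->; case: ifP. Qed.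

(** The bumped entry is the first one exceeding x; since x does not occur in the row, the entries
    before it are strictly smaller than x. *)
Lemma row_ins_spec x r : sorted ltn r -> x \notin r ->
  (row_ins x r = (None, rcons r x) /\ all (ltn^~ x) r) \/
  exists r1 y r2, [/\ r = r1 ++ y :: r2, row_ins x r = (Some y, r1 ++ x :: r2),
    x < y, all (ltn^~ x) r1 & path ltn y r2].
Proof.
move=> sr xr; rewrite row_insE set_nthE -has_find.
have lt s : {subset s <= r} -> ~~ has (ltn x) s -> all (ltn^~ x) s.
  move=> sub /hasPn H; apply/allP=> a /[dup] /H /= ax /sub ar.
  by rewrite ltn_neqAle leqNgt ax andbT; apply: contraNneq xr => <-.
case: (boolP (has (ltn x) r)) => hr; [right | left].
- case/(split_find_nth 0): hr sr lt => y r1 r2 /= xy hr1 sr lt.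
  exists r1, y, r2; split; rewrite ?cat_rcons //; last first.
    by move: sr; rewrite cat_rcons; case: r1 {lt hr1} => [|a r1] //=; rewrite cat_path /= => /and3P[].
  by apply: lt => // a; rewrite cat_rcons mem_cat => ->.
- by rewrite (hasNfind hr) subnn /= cats1; split => //; exact: lt.
Qed.

(** The condition for [s] to stand directly below [r] in a tableau with strictly increasing
    columns. *)
Definition dominates (r s : seq nat) :=
  (size s <= size r) && all (fun i => nth 0 r i < nth 0 s i) (iota 0 (size s)).

Lemma dominatesP r s :
  reflect (size s <= size r /\ forall i, i < size s -> nth 0 r i < nth 0 s i)
          (dominates r s).
Proof.
apply: (iffP andP) => -[h H]; split=> //.
  by move=> i hi; apply: (allP H); rewrite mem_iota.
by apply/allP=> i; rewrite mem_iota => /= hi; apply: H.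
Qed.

Lemma dominates_trans : transitive dominates.
Proof.
move=> b a c /dominatesP[h H] /dominatesP[h' H']; apply/dominatesP.
split=> [|i ic]; first exact: leq_trans h.
by apply: ltn_trans (H' _ ic); apply: H; exact: leq_trans h'.
Qed.

Lemma nth_sorted_ltn r i j : sorted ltn r -> i < j -> j < size r -> nth 0 r i < nth 0 r j.
Proof. by move=> sr ij jr; apply: (sorted_ltn_nth ltn_trans) => //; rewrite inE // (ltn_trans ij). Qed.

(** The bumped y moves weakly left, because the entry of [s] below its old place, if any, exceeds y.
    Above its new place then stands either x or an entry formerly to the left of y, and both are
    smaller than y. *)
Lemma dominates_row_ins x y r r' s : sorted ltn r ->
  row_ins x r = (Some y, r') -> dominates r s -> dominates r' (row_ins y s).2.
Proof.
move=> sr; rewrite row_insE; case: ifP => // pr [yE <-] /dominatesP[h H].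
rewrite row_insE /=; set p := find _ r in pr yE *; set q := find _ s.
have xy : x < y by rewrite -yE; apply: (@nth_find _ 0 (ltn x)); rewrite has_find.
have qp : q <= p.
  rewrite leqNgt; apply/negP=> pq.
  have ps : p < size s by apply: leq_trans pq (find_size _ _).
  by have := before_find 0 pq; rewrite /= -yE H.
have r'r i : i < size r -> nth 0 (set_nth 0 r p x) i <= nth 0 r i.
  by move=> ir; rewrite nth_set_nth /=; case: eqP => // ->; rewrite yE ltnW.
apply/dominatesP; rewrite !size_set_nth; split=> [|i].
  by rewrite geq_max !leq_max h !ltnS qp /= orbT.
rewrite [nth 0 (set_nth _ s _ _) i]nth_set_nth /=; case: eqP => [-> _|/eqP iq].
  rewrite nth_set_nth /=; case: eqP => [//|/eqP npq].
  by rewrite -yE nth_sorted_ltn // ltn_neqAle npq.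
rewrite leq_max => /orP[|is_].
  rewrite ltnS leq_eqVlt (negPf iq) /= => iq'.
  have is_ : i < size s by apply: leq_trans iq' (find_size _ _).
  by apply: leq_ltn_trans (H _ is_); apply: r'r; exact: leq_trans h.
by apply: leq_ltn_trans (H _ is_); apply: r'r; exact: leq_trans h.
Qed.

(** The row reading word, lowest row first, so that a letter to be inserted follows the first row
    directly. *)
Definition reading (T : seq (seq nat)) := flatten (rev T).

Lemma reading_cons r T : reading (r :: T) = reading T ++ r.
Proof. by rewrite /reading rev_cons -cats1 flatten_cat /= cats0. Qed.

Definition is_tableau T := all (sorted ltn) T && sorted dominates T.

Lemma rsk_ins_head x r T :
  exists T', rsk_ins x (r :: T) = (row_ins x r).2 :: T'.
Proof. by rewrite /=; case: row_ins => -[y|] r' /=; eexists. Qed.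

Lemma rsk_ins_perm x T : perm_eq (reading (rsk_ins x T)) (x :: reading T).
Proof.
elim: T x => [|r T IH] x //=.
have E : perm_eq (row_ins x r).2 (x :: r) /\ (row_ins x r).1 = None \/
   exists2 y, (row_ins x r).1 = Some y & perm_eq (y :: (row_ins x r).2) (x :: r).
  elim: r => [|y r IHr] /=; first by left.
  case: ifP => _; first by right; exists y => //=; apply/seq.permP=> a /=; lia.
  case: (row_ins x r) IHr => b r' /= [[H ->]|[z -> H]]; [left|right; exists z => //];
    [split=> //|]; move/seq.permP: H => H; apply/seq.permP=> a; move: (H a) => /=; lia.
case: (row_ins x r) E => b r' /= [[/seq.permP H ->]|[y -> /seq.permP H]].
  by rewrite !reading_cons; apply/seq.permP=> a; rewrite /= !count_cat H /=; lia.
rewrite !reading_cons; apply/seq.permP=> a; have := H a.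
by rewrite /= !count_cat (seq.permP (IH y)) /=; lia.
Qed.

Lemma rsk_ins_tableau x T : is_tableau T -> uniq (x :: reading T) -> is_tableau (rsk_ins x T).
Proof.
elim: T x => [|r T IH] x //; rewrite reading_cons /is_tableau /= => /andP[/andP[sr sT] pT].
rewrite mem_cat negb_or => /andP[/andP[xT xr]]; rewrite cat_uniq => /and3P[UT Dr Ur].
case: (row_ins_spec sr xr) => [[-> ar]|[r1 [y [r2 [E ins xy a1 p2]]]]].
- rewrite /= sT andbT; apply/andP; split.
    rewrite (sorted_pairwise ltn_trans) pairwise_rcons -(sorted_pairwise ltn_trans) sr andbT.
    exact: ar.
  case: T pT {IH sT xT UT Dr} => //= s T /andP[/dominatesP[h H] ->]; rewrite andbT.
  apply/dominatesP; rewrite size_rcons; split; first exact: leqW.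
  by move=> i is_; rewrite nth_rcons (leq_trans is_ h) H.
- have yr : y \in r by rewrite E mem_cat inE eqxx orbT.
  have yT : y \notin reading T by move/hasPn: Dr; apply.
  have /andP[IH1 IH2] : is_tableau (rsk_ins y T).
    by apply: IH; rewrite /= ?yT ?UT // /is_tableau sT (path_sorted pT).
  rewrite ins /= IH1 andbT; apply/andP; split.
    move: sr; rewrite E !(sorted_pairwise ltn_trans) !pairwise_cat /= !allrel_consr.
    case/and3P=> /andP[_ ->] -> /andP[y2 ->]; rewrite !andbT; apply/andP; split; first exact: a1.
    by apply: sub_all y2 => z; exact: ltn_trans xy.
  have D s : dominates r s -> dominates (r1 ++ x :: r2) (row_ins y s).2.
    exact: (dominates_row_ins sr ins).
  case: T pT IH2 {IH sT xT UT Dr yT IH1} => [|s T] pT.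
    (* Opening a new row amounts to inserting into an empty row. *)
    move=> _ /=; rewrite andbT; apply: (D [::]); exact/dominatesP.
  have [T' ->] := rsk_ins_head y s T; rewrite /= => ->; rewrite andbT.
  by apply: D; case/andP: pT.
Qed.

(** Knuth relations turn r1 y r2 x into r1 y x r2 and then into y r1 x r2. Now y directly follows
    the reading word of the lower rows, and the induction hypothesis inserts it there, with r1 x r2
    absorbed into the arbitrary suffix [v]. *)
Lemma incr_cover_rsk_ins k m x T v : is_tableau T -> uniq (x :: reading T ++ v) ->
  incr_cover k (reading T ++ x :: v) m <-> incr_cover k (reading (rsk_ins x T) ++ v) m.
Proof.
elim: T x v => [|r T IH] x v; first by [].
rewrite /is_tableau reading_cons => /andP[/= /andP[sr sT] pT] /andP[nx U].
have xr : x \notin r by move: nx; rewrite !mem_cat !negb_or => /andP[/andP[]].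
case: (row_ins_spec sr xr) => [[-> ar]|[r1 [y [r2 [E -> xy a1 p2]]]]].
  by rewrite reading_cons -!catA cat_rcons.
have Uy : uniq (reading T ++ r1 ++ y :: r2 ++ x :: v).
  rewrite (perm_uniq (s2 := x :: (reading T ++ r) ++ v)) /= ?nx // E.
  by apply/seq.permP=> a /=; rewrite !count_cat /= !count_cat /=; lia.
rewrite reading_cons E -!catA /= -IH; first last.
- rewrite -(perm_uniq (s1 := reading T ++ r1 ++ y :: r2 ++ x :: v)) //.
  by apply/seq.permP=> a /=; rewrite !count_cat /= !count_cat /=; lia.
- by rewrite /is_tableau sT (path_sorted pT).
have C1 w : reading T ++ r1 ++ w = (reading T ++ r1) ++ w by rewrite catA.
rewrite C1 incr_cover_shift_left -?C1 //.
have sr1 : sorted ltn r1.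
  by move: sr; rewrite E !(sorted_pairwise ltn_trans) pairwise_cat => /and3P[].
apply: incr_cover_shift_right => //.
rewrite -(perm_uniq (s1 := reading T ++ r1 ++ y :: r2 ++ x :: v)) //.
by apply/seq.permP=> a /=; rewrite !count_cat /= !count_cat /=; lia.
Qed.

(** * Invariance along the whole insertion process *)

Definition rsk_tab w := foldl (fun T x => rsk_ins x T) [::] w.

Lemma rsk_tab_perm w : perm_eq (reading (rsk_tab w)) w.
Proof.
elim/last_ind: w => [|w x IH] //; rewrite /rsk_tab foldl_rcons.
by rewrite (permPl (rsk_ins_perm _ _)) perm_sym perm_rcons perm_cons perm_sym.
Qed.

Lemma rsk_tab_tableau w : uniq w -> is_tableau (rsk_tab w).
Proof.
elim/last_ind: w => [|w x IH] //; rewrite rcons_uniq /rsk_tab foldl_rcons => /andP[xw uw].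
apply: rsk_ins_tableau; first exact: IH.
by rewrite /= (perm_mem (rsk_tab_perm w)) xw (perm_uniq (rsk_tab_perm w)).
Qed.

Lemma incr_cover_rsk k m w : uniq w ->
  incr_cover k w m <-> incr_cover k (reading (rsk_tab w)) m.
Proof.
(* The suffix [v] holds the letters still to be inserted. *)
suff H v : uniq (w ++ v) -> incr_cover k (w ++ v) m <-> incr_cover k (reading (rsk_tab w) ++ v) m.
  by have := H [::]; rewrite !cats0.
elim/last_ind: w v => [|w x IH] v //; rewrite cat_rcons => U.
rewrite IH // /rsk_tab foldl_rcons; apply: incr_cover_rsk_ins.
  by apply: rsk_tab_tableau; move: U; rewrite cat_uniq => /and3P[].
rewrite (perm_uniq (s2 := w ++ x :: v)) //.
by apply/seq.permP=> a; rewrite /= !count_cat (seq.permP (rsk_tab_perm w)) /=; lia.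
Qed.

(** * Greene's theorem *)

Lemma mem_reading x T : (x \in reading T) = has (fun r => x \in r) T.
Proof. by elim: T => //= r T IH; rewrite reading_cons mem_cat IH orbC. Qed.

(** The first k rows are themselves disjoint increasing subsequences, each coloured by its index;
    this is the lower bound. *)
Lemma incr_cover_tableau_rows k T :
    is_tableau T -> uniq (reading T) ->
  incr_cover k (reading T) (sumn (take k (shape T))).
Proof.
elim: T k => [|r T IH] [|k]; rewrite /is_tableau /=.
- by exists id.
- by exists id.
- move=> _ _; exists (fun _ => 0) => //.
  by apply: (@sub_pairwise _ (fun _ _ => true)); [move=> a b _; exact/incr_relP | elim: (reading _) => //= a s ->; rewrite all_predT].
rewrite reading_cons cat_uniq => /andP[/andP[sr sT] pT] /and3P[UT /hasPn D Ur].
have tT : is_tableau T by rewrite /is_tableau sT (path_sorted pT).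
have [c G cm] := IH k tT UT.
have {IH}nr x : x \in reading T -> x \in r = false.
  by move=> xT; apply/negP=> /D /=; rewrite xT.
exists (fun x => if x \in r then 0 else (c x).+1).
- rewrite pairwise_cat; apply/and3P; split.
  + by apply/allrelP=> a b aT br; apply/incr_relP; rewrite (nr _ aT) br.
  + apply: (sub_in_pairwise (P := mem (reading T))) G; last by apply/allP.
    move=> a b aT bT /incr_relP H; apply/incr_relP; rewrite !nr // => -[e].
    by rewrite ltnS; exact: H.
  + rewrite (sorted_pairwise ltn_trans) in sr; apply: sub_pairwise sr.
    by move=> a b ab; apply/incr_relP.
- change (size r + sumn (take k (shape T)) <= count (fun x => (if x \in r then 0 else (c x).+1) < k.+1) (reading T ++ r)).
  rewrite count_cat [leqRHS]addnC; apply: leq_add.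
    rewrite -(count_predT r) (@eq_in_count _ predT (fun x => (if x \in r then 0 else (c x).+1) < k.+1)) //.
    by move=> a /= ->.
  apply: (leq_trans cm); rewrite (@eq_in_count _ _ (fun x => (if x \in r then 0 else (c x).+1) < k.+1)) //.
  by move=> a /nr /= ->.
Qed.

(** In a weakly decreasing list the entries exceeding j come first. *)
Lemma count_take_sorted s j k :
  sorted geq s -> minn k (count (ltn j) s) <= count (ltn j) (take k s).
Proof.
elim: s k => [|a s IH] [|k] //= pa; rewrite ?minn0 ?min0n //.
have := IH k (path_sorted pa); case: (ltnP j a) => aj; first by rewrite minnSS.
have -> : count (ltn j) s = 0; last by rewrite minn0.
apply/eqP; rewrite -leqn0 leqNgt -has_count; apply/hasPn => b bs /=.
have : all (geq a) s by apply: (order_path_min _ pa) => x y z /= h1 h2; exact: leq_trans h1.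
by move/allP=> /(_ b bs) /= ba; rewrite -leqNgt (leq_trans ba).
Qed.

Lemma tableau_shape_sorted T : is_tableau T -> sorted geq (shape T).
Proof.
case/andP=> _; case: T => [|r T] //=; elim: T r => [|s T IH] r //= /andP[/dominatesP[h _] /IH ->].
by rewrite /= h.
Qed.

(* A column is read bottom to top, hence decreasingly, so its selected
   entries all have different colours. *)
Lemma uniq_column_colours k c T j (P := fun r => (j < size r) && (c (nth 0 r j) < k)) :
    pairwise dominates T -> pairwise (incr_rel k c) (reading T) ->
  uniq [seq c (nth 0 r j) | r <- T & P r].
Proof.
elim: T => [|r T IH] //= /andP[/allP dT pT]; rewrite reading_cons => G.
have : uniq [seq c (nth 0 r0 j) | r0 <- T & P r0].
  by apply: IH => //; move: G; rewrite pairwise_cat => /and3P[].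
case: ifP => // /andP[jr ck] /= ->; rewrite andbT.
apply/mapP=> -[s]; rewrite mem_filter => /andP[/andP[js cs] sT] e.
have sR : nth 0 s j \in reading T by rewrite mem_reading; apply/hasP; exists s; rewrite ?mem_nth.
have /incr_relP := pairwise_cat_mem G sR (mem_nth 0 jr); rewrite e => /(_ erefl cs).
by have /dominatesP[_ /(_ _ js)] := dT _ sT; rewrite ltnNge => /negP h /ltnW.
Qed.

Lemma sum_count_columns N (P : pred nat) T : all (fun r => size r <= N) T ->
  \sum_(r <- T) count P r =
  \sum_(j < N) count (fun r => (j < size r) && P (nth 0 r j)) T.
Proof.
move=> /allP TN; under [RHS]eq_bigr => j _ do rewrite -sum1_count big_mkcond /=.
rewrite exchange_big /= [LHS]big_seq [RHS]big_seq; apply: eq_bigr => r /TN rN.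
rewrite -sum1_count big_mkcond /= (big_nth 0) big_mkord (big_ord_widen N (fun j => if P (nth 0 r j) then 1 else 0)) //.
by rewrite big_mkcond; apply: eq_bigr => j _; case: (j < size r).
Qed.

(** By the pigeonhole principle on colours, a column contains at most min(k, height) selected
    letters. Summed over the columns, this counts the cells of the first k rows. *)
Lemma incr_cover_tableau_le k T m :
  is_tableau T -> incr_cover k (reading T) m -> m <= sumn (take k (shape T)).
Proof.
move=> tT [c G cm]; apply: (leq_trans cm).
have [N TN] : exists N, all (fun r => size r <= N) T.
  exists (sumn (shape T)); elim: (T) => //= r s IH; rewrite leq_addr /=.
  by apply: sub_all IH => a /leq_trans; apply; exact: leq_addl.
have dT : pairwise dominates T.
  by rewrite -(sorted_pairwise dominates_trans); case/andP: tT.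
have -> : count (fun x => c x < k) (reading T) = \sum_(r <- T) count (fun x => c x < k) r.
  by elim: (T) => [|r s IH]; rewrite ?big_nil // reading_cons count_cat IH big_cons addnC.
have TkN : all (fun r => size r <= N) (take k T).
  by apply/allP=> r /mem_take; exact: (allP TN).
have -> : sumn (take k (shape T)) = \sum_(r <- take k T) count predT r.
  by rewrite /shape -map_take sumnE big_map; apply: eq_bigr => r _; rewrite count_predT.
rewrite (sum_count_columns _ TN) (sum_count_columns _ TkN); apply: leq_sum => j _.
have -> : count (fun r => (j < size r) && predT (nth 0 r j)) (take k T) = count (ltn j) (take k (shape T)).
  by rewrite /shape -map_take count_map; apply: eq_count => r; rewrite /= andbT.
apply: leq_trans (count_take_sorted _ _ (tableau_shape_sorted tT)).
rewrite leq_min; apply/andP; split; last first.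
  by rewrite /shape count_map; apply: sub_count => r /= /andP[].
rewrite -size_filter -(size_map (fun r => c (nth 0 r j))) -[X in _ <= X](size_iota 0).
apply: uniq_leq_size; first exact: uniq_column_colours.
by move=> i /mapP[r]; rewrite mem_filter mem_iota => /andP[/andP[_ h] _] ->.
Qed.

(** Insertion carries the question from the word to the reading word of its tableau, where the rows
    provide a cover and the columns bound every cover. *)
Lemma greene k w m : uniq w ->
  incr_cover k w m <-> m <= sumn (take k (shape (rsk_tab w))).
Proof.
move=> uw; have tT := rsk_tab_tableau uw.
rewrite (incr_cover_rsk k m uw); split; first exact: incr_cover_tableau_le.
move=> h; have uT : uniq (reading (rsk_tab w)) by rewrite (perm_uniq (rsk_tab_perm w)).
have [c G cm] := incr_cover_tableau_rows k tT uT.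
by exists c => //; exact: leq_trans cm.
Qed.

(** * Row sums under exchanges of consecutive values *)

Definition swap_val a x := if x == a then a.+1 else if x == a.+1 then a else x.

Lemma swap_valK a : involutive (swap_val a).
Proof. by move=> x; rewrite /swap_val; do !case: eqP => //; lia. Qed.

(** Only the relative order of a and a + 1 changes, so giving a the unselected colour [k] repairs
    the colouring at the cost of at most one letter. *)
Lemma incr_cover_swap_val k a w m : uniq w ->
  incr_cover k w m -> incr_cover k (map (swap_val a) w) m.-1.
Proof.
move=> uw [c G cm]; pose d x := if x == a then k else c x.
have dk x : (d x < k) = (x != a) && (c x < k).
  by rewrite /d; case: eqP => //; rewrite ltnn.
exists (fun x => d (swap_val a x)).
- rewrite pairwise_map; apply: sub_pairwise G => x y /incr_relP H.
  apply/incr_relP; rewrite !swap_valK => e dx.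
  have dy : d y < k by rewrite -e.
  move: dx dy e; rewrite !dk /d => /andP[xa cx] /andP[ya cy].
  rewrite (negPf xa) (negPf ya) => e; have := H e cx.
  rewrite /swap_val (negPf xa) (negPf ya); move/eqP: xa; move/eqP: ya; clear.
  by do !case: eqP; lia.
- rewrite count_map (@eq_count _ _ (fun x => d x < k)); last by move=> x; rewrite /= swap_valK.
  have : count (fun x => c x < k) w <= count (fun x => d x < k) w + count_mem a w.
    rewrite -count_predUI; apply: leq_trans (leq_addr _ _).
    by apply: sub_count => x /= h; rewrite dk h andbT orNb.
  by rewrite count_uniq_mem //; case: (a \in w) cm => /= cm h; lia.
Qed.

Lemma rsk_shape_tab n (p : 'S_n) : rsk_shape p = shape (rsk_tab (one_line p)).
Proof. by []. Qed.

Lemma one_line_uniq n (p : 'S_n) : uniq (one_line p).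
Proof. by rewrite map_inj_uniq ?enum_uniq // => i j /val_inj /perm_inj. Qed.

Lemma one_line_adj_left n a (p : 'S_n) : a.+1 < n ->
  one_line (adj_left a p) = map (swap_val a) (one_line p).
Proof.
move=> an; rewrite /adj_left !insubT ?(ltnW an) // => an'.
rewrite /one_line -[RHS]map_comp; apply: eq_map => i /=; rewrite permM.
case: tpermP => [->|->|/eqP h1 /eqP h2] /=; rewrite /swap_val.
- by rewrite eqxx.
- by rewrite eqxx; case: eqP => //; lia.
- have -> : (val (p i) == a) = false by apply/negbTE; apply: contra h1.
  by have -> : (val (p i) == a.+1) = false by apply/negbTE; apply: contra h2.
Qed.

Definition row_sum k (la : seq nat) := sumn (take k la).

Lemma row_sum_adj_left n a (p : 'S_n) k : a.+1 < n ->
  row_sum k (rsk_shape p) <= row_sum k (rsk_shape (adj_left a p)) + 1 /\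
  row_sum k (rsk_shape (adj_left a p)) <= row_sum k (rsk_shape p) + 1.
Proof.
move=> an; have U := one_line_uniq p; have E := one_line_adj_left p an.
have U' := one_line_uniq (adj_left a p).
have step (q r : 'S_n) : one_line r = map (swap_val a) (one_line q) ->
    row_sum k (rsk_shape q) <= row_sum k (rsk_shape r) + 1.
  move=> e; rewrite /row_sum !rsk_shape_tab [_ + 1]addnC -leq_subLR subn1; apply/(greene _ _ (one_line_uniq r)).
  by rewrite e; apply: incr_cover_swap_val (one_line_uniq q) _; apply/(greene _ _ (one_line_uniq q)).
(* The exchange of values is an involution, so the one-sided bound applies in both directions. *)
split; apply: step => //; rewrite E -map_comp.
by rewrite -[LHS]map_id; apply: eq_map => x; rewrite /= swap_valK.
Qed.

Lemma row_sum_reach n m (p q : 'S_n) k : reach_in m p q ->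
  row_sum k (rsk_shape p) <= row_sum k (rsk_shape q) + m /\
  row_sum k (rsk_shape q) <= row_sum k (rsk_shape p) + m.
Proof.
case=> ks [<- []]; elim: ks p => [|a ks IH] p /=; first by move=> _ ->; rewrite addn0.
case/andP=> an /IH{}IH /IH[h1 h2]; have [h3 h4] := row_sum_adj_left p k an.
by split; lia.
Qed.

Lemma rsk_shape_sorted n (p : 'S_n) : sorted geq (rsk_shape p).
Proof. exact: tableau_shape_sorted (rsk_tab_tableau (one_line_uniq p)). Qed.

Lemma sumn_rsk_shape n (p : 'S_n) : sumn (rsk_shape p) = n.
Proof.
have sw : size (one_line p) = n by rewrite size_map size_enum_ord.
rewrite rsk_shape_tab -[RHS]sw -(perm_size (rsk_tab_perm (one_line p))) /reading.
by rewrite size_flatten /shape map_rev sumn_rev.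
Qed.

(** * Summation by columns *)

(** For the row lengths of a shape, h is the height of column c, cut off at N. *)
Lemma antitone_threshold (a : nat -> nat) c N : {homo a : i j / i <= j >-> j <= i} ->
  exists2 h, h <= N & forall i, i < N -> (c < a i) = (i < h).
Proof.
move=> ma; elim: N => [|N [h hN H]]; first by exists 0.
case: (ltnP c (a N)) => cN.
  exists N.+1 => // i iN; rewrite iN (leq_trans cN) //; exact: ma.
exists h => [|i]; first exact: leqW.
rewrite ltnS leq_eqVlt => /orP[/eqP->|/H //].
by rewrite !ltnNge cN hN.
Qed.

Lemma sum_interval (F : nat -> nat) l h N : h <= N ->
  \sum_(0 <= i < N | l <= i < h) F i = \sum_(l <= i < h) F i.
Proof.
move=> hN; rewrite [RHS](big_nat_widen _ _ N) // [RHS](big_nat_widenl _ 0) //.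
by apply: eq_bigl => i; rewrite /= andbC.
Qed.

(** One factor of the square is expanded into the cells of row i that lie in a but not in b, and the
    sums are interchanged. In column c the rows concerned form an interval from l to h; their
    weights are at most h, and f sums to at most 2t over them. The heights h add up to the sum of
    a. *)
Lemma weighted_sum_sqr_sub_le (a b : nat -> nat) t N :
    {homo a : i j / i <= j >-> j <= i} -> {homo b : i j / i <= j >-> j <= i} ->
    (forall k, \sum_(0 <= i < k) a i <= \sum_(0 <= i < k) b i + t) ->
    (forall k, \sum_(0 <= i < k) b i <= \sum_(0 <= i < k) a i + t) ->
  \sum_(0 <= i < N) i.+1 * (a i - b i) ^ 2 <= 2 * t * \sum_(0 <= i < N) a i.
Proof.
move=> ma mb ab ba; pose f i := a i - b i.
have ind (F : nat -> nat) i : F i * f i = \sum_(0 <= c < a 0 | b i <= c < a i) F i.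
  rewrite sum_interval; last exact: ma.
  by rewrite sum_nat_const_nat mulnC.
have -> : \sum_(0 <= i < N) i.+1 * (a i - b i) ^ 2 =
   \sum_(0 <= c < a 0) \sum_(0 <= i < N | b i <= c < a i) i.+1 * f i.
  under eq_bigr => i _ do rewrite -mulnn mulnA -/(f i) (ind (fun i => i.+1 * f i)) big_mkcond.
  by rewrite exchange_big_nat; apply: eq_bigr => c _; rewrite [RHS]big_mkcond.
have -> : \sum_(0 <= i < N) a i = \sum_(0 <= c < a 0) \sum_(0 <= i < N | c < a i) 1.
  rewrite [RHS](eq_bigr (fun c => \sum_(0 <= i < N) (c < a i))); last first.
    by move=> c _; rewrite big_mkcond; apply: eq_bigr => i _; case: ifP.
  rewrite exchange_big_nat; apply: eq_bigr => i _.
  rewrite -[LHS]subn0 -[LHS]muln1 -sum_nat_const_nat -(@sum_interval _ 0 _ (a 0)) ?ma //.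
  by rewrite big_mkcond; apply: eq_bigr => c _ /=; case: (c < a i).
rewrite big_distrr /=; apply: leq_sum => c _.
have [h hN Hh] := antitone_threshold c N ma.
have [l lN Hl] := antitone_threshold c N mb.
have -> : \sum_(0 <= i < N | c < a i) 1 = h.
  rewrite big_nat_cond (eq_bigl (fun i => (0 <= i < N) && (0 <= i < h))).
    by rewrite -big_nat_cond sum_interval // sum_nat_const_nat subn0 muln1.
  by move=> i /=; case: (ltnP i N) => //= iN; rewrite Hh.
rewrite big_nat_cond (eq_bigl (fun i => (0 <= i < N) && (l <= i < h))); last first.
  by move=> i /=; case: (ltnP i N) => //= iN; rewrite Hh // [b i <= c]leqNgt Hl // -leqNgt.
rewrite -big_nat_cond sum_interval //.
apply: (@leq_trans (\sum_(l <= i < h) h * f i)).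
  by rewrite big_nat [X in _ <= X]big_nat; apply: leq_sum => i /andP[_ ih]; rewrite leq_mul2r ih orbT.
rewrite -big_distrr /= mulnC leq_mul2r; apply/orP; right.
case: (leqP l h) => lh; last by rewrite big_geq // ltnW.
(* On this interval b_i <= c < a_i, so the truncated difference is exact. *)
have E : \sum_(l <= i < h) f i + \sum_(l <= i < h) b i = \sum_(l <= i < h) a i.
  rewrite -big_split /= big_nat [RHS]big_nat; apply: eq_bigr => i /andP[li ih].
  have iN : i < N := leq_trans ih hN.
  rewrite /f subnK //; apply: (@leq_trans c); first by rewrite leqNgt Hl // -leqNgt.
  by apply: ltnW; rewrite Hh.
have split_l F : \sum_(0 <= i < h) F i = \sum_(0 <= i < l) F i + \sum_(l <= i < h) F i.
  by rewrite (@big_cat_nat _ _ _ l).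
(* The partial sums at h and at l each contribute an error of t, whence 2t. *)
have := ab h; have := ba l; rewrite !split_l -E.
by clear; lia.
Qed.

Lemma sum_nth_row_sum la k : \sum_(0 <= i < k) nth 0 la i = row_sum k la.
Proof.
rewrite /row_sum; elim: la k => [|a la IH] [|k]; rewrite ?big_nil ?big_mkord ?big_ord0 //.
  by rewrite big1 // => i _; rewrite nth_nil.
by rewrite -(big_mkord xpredT (nth 0 (a :: la))) big_nat_recl //= IH.
Qed.

Lemma nth_sorted_geq la : sorted geq la -> {homo nth 0 la : i j / i <= j >-> j <= i}.
Proof.
move=> sla i j ij; case: (ltnP j (size la)) => jl; last by rewrite nth_default.
have T : transitive geq by move=> x y z /= h1 h2; exact: leq_trans h1.
apply: (sorted_leq_nth T _ 0 sla); rewrite ?inE // ?(leq_ltn_trans ij) //; exact: leqnn.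
Qed.

Lemma row_sum_le k la : row_sum k la <= sumn la.
Proof. by rewrite /row_sum -{2}(cat_take_drop k la) sumn_cat leq_addr. Qed.

Lemma row_sub_le la mu t :
    (forall k, row_sum k la <= row_sum k mu + t) ->
    (forall k, row_sum k mu <= row_sum k la + t) ->
  forall i, nth 0 la i - nth 0 mu i <= 2 * t.
Proof.
move=> H1 H2 i; have := H1 i.+1; have := H2 i.
by rewrite -!sum_nth_row_sum !big_nat_recr //=; lia.
Qed.

Lemma shape_weighted_sum_sqr_le la mu t N :
    (forall k, row_sum k la <= row_sum k mu + t) ->
    (forall k, row_sum k mu <= row_sum k la + t) ->
    sorted geq la -> sorted geq mu ->
  \sum_(0 <= i < N) i.+1 * (nth 0 la i - nth 0 mu i) ^ 2 <= 2 * t * sumn la.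
Proof.
move=> H1 H2 sla smu.
apply: leq_trans (weighted_sum_sqr_sub_le (t := t) N (nth_sorted_geq sla) (nth_sorted_geq smu) _ _) _.
- by move=> k; rewrite !sum_nth_row_sum.
- by move=> k; rewrite !sum_nth_row_sum.
- by rewrite sum_nth_row_sum leq_mul2l row_sum_le orbT.
Qed.

(** * Estimates over the reals *)

Local Open Scope R_scope.

Definition Rsum (F : nat -> R) N := foldr Rplus 0 [seq F i | i <- iota 0 N].

Lemma RsumS F N : Rsum F N.+1 = Rsum F N + F N.
Proof.
rewrite /Rsum -addn1 iotaD map_cat foldr_cat /= add0n.
elim: [seq F i | i <- iota 0 N] => [|x s IH] /=; first lra.
by rewrite IH; lra.
Qed.

Lemma Rsum_le F G N : (forall i, F i <= G i) -> Rsum F N <= Rsum G N.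
Proof.
move=> H; elim: N => [|N IH]; first by rewrite /Rsum /=; lra.
by rewrite !RsumS; have := H N; lra.
Qed.

Lemma Rsum_add F G N : Rsum (fun i => F i + G i) N = Rsum F N + Rsum G N.
Proof. by elim: N => [|N IH]; rewrite ?RsumS ?IH /Rsum /=; lra. Qed.

Lemma Rsum_scal c F N : Rsum (fun i => c * F i) N = c * Rsum F N.
Proof. by elim: N => [|N IH]; rewrite ?RsumS ?IH /Rsum /=; lra. Qed.

Lemma INR_sum (F : nat -> nat) N :
  INR (\sum_(0 <= i < N) F i)%N = Rsum (fun i => INR (F i)) N.
Proof.
elim: N => [|N IH]; first by rewrite big_geq.
by rewrite big_nat_recr //= RsumS -IH -plus_INR.
Qed.

(** At most sqrt(n / t) indices pass the test and each contributes t, which makes sqrt(n t), the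
    value of [S]. *)
Lemma Rsum_head_le (n t S : R) N : 0 < t -> 0 <= S -> S * S = n * t ->
  Rsum (fun i => if Rle_dec (INR i.+1 * INR i.+1 * t) n then t else 0) N <= S.
Proof.
move=> t0 S0 SS.
set F := fun _ => _.
(* The second bound is carried along because, at an index that passes the test, (M + 1) t <= S
   bounds the whole sum so far. *)
suff H M : Rsum F M <= S /\ Rsum F M <= INR M * t by case: (H N).
elim: M => [|M [IH1 IH2]]; first by rewrite /Rsum /=; lra.
rewrite RsumS {2 4}/F; case: Rle_dec => h; rewrite /is_left; last by rewrite S_INR; split; lra.
have h1 : INR M.+1 * t <= S.
  apply: Rsqr_incr_0_var => //; rewrite /Rsqr SS.
  have -> : INR M.+1 * t * (INR M.+1 * t) = (INR M.+1 * INR M.+1 * t) * t by ring.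
  by apply: Rmult_le_compat_r h; lra.
by move: h1; rewrite S_INR; split; lra.
Qed.

(** This is ln u <= u - 1 at u = x / y, used to telescope a harmonic sum. *)
Lemma inv_le_ln_sub (x y : R) : 0 < x -> x + 1 <= y -> / y <= ln y - ln x.
Proof.
move=> x0 xy.
have h : ln (x / y) <= x / y - 1.
  have := exp_ineq1_le (ln (x / y)).
  by rewrite exp_ln; [lra | apply: Rdiv_lt_0_compat; lra].
rewrite {1}/Rdiv ln_mult ?ln_Rinv in h; try lra; last by apply: Rinv_0_lt_compat; lra.
have : x / y <= 1 - / y; last by lra.
apply: (Rmult_le_reg_r y); first lra.
by rewrite /Rdiv Rmult_assoc Rmult_minus_distr_r !Rinv_l; lra.
Qed.

(** If n / t < i^2 and j^2 <= n t, then j / i < t; the harmonic sum from i to j is at most 1 + ln (j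
    / i). *)
Lemma Rsum_harmonic_le (n t : R) N : 0 <= n -> 1 <= t ->
  Rsum (fun i => if Rle_dec (INR i.+1 * INR i.+1 * t) n then 0 else
                 if Rle_dec (INR i.+1 * INR i.+1) (n * t) then / INR i.+1 else 0) N
  <= 1 + ln t.
Proof.
move=> n0 t1; set F := fun _ => _.
have lnt : 0 <= ln t by rewrite -ln_1; case: t1 => [h|<-]; [apply: Rlt_le; apply: ln_increasing; lra | lra].
have pos i : 1 <= INR i.+1 by rewrite S_INR; have := pos_INR i; lra.
(* Either no index has contributed yet, or [i0] is the first and [M] the latest that did. *)
suff [H|[i0 [M [_ [h1 [h2 H]]]]]] : Rsum F N <= 0 \/ exists i0 M, (M < N)%N /\
    n < INR i0.+1 * INR i0.+1 * t /\ INR M.+1 * INR M.+1 <= n * t /\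
    Rsum F N <= 1 + ln (INR M.+1) - ln (INR i0.+1).
- lra.
- have Mi : INR M.+1 <= t * INR i0.+1.
    apply: Rsqr_incr_0_var; last by have := pos i0; nra.
    have := pos i0; rewrite /Rsqr => p; apply: (Rle_trans _ _ _ h2).
    have -> : t * INR i0.+1 * (t * INR i0.+1) = (INR i0.+1 * INR i0.+1 * t) * t by ring.
    by apply: Rmult_le_compat_r; lra.
  have : ln (INR M.+1) <= ln (t * INR i0.+1).
    case: Mi => [h|->]; last lra.
    by apply: Rlt_le; apply: ln_increasing => //; have := pos M; lra.
  by rewrite ln_mult; [lra|lra|have := pos i0; lra].
elim: N => [|N IH]; first by left; rewrite /Rsum /=; lra.
rewrite RsumS {2 4}/F; case: Rle_dec => h1; rewrite /is_left.
  case: IH => [|[i0 [M [? [? [? ?]]]]]]; [left; lra|right; exists i0, M].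
  by do !split => //; [exact: leqW | lra].
case: Rle_dec => h2; rewrite /is_left; last first.
  case: IH => [|[i0 [M [? [? [? ?]]]]]]; [left; lra|right; exists i0, M].
  by do !split => //; [exact: leqW | lra].
right; case: IH => [IH|[i0 [M [MN [g1 [g2 IH]]]]]].
  exists N, N; do !split => //; first lra.
  have : / INR N.+1 <= / 1 by apply: Rinv_le_contravar; [lra | exact: pos].
  by rewrite Rinv_1; lra.
exists i0, N; do !split => //.
have : / INR N.+1 <= ln (INR N.+1) - ln (INR M.+1); last by lra.
apply: inv_le_ln_sub; first by have := pos M; lra.
by rewrite -S_INR; apply: le_INR; apply/leP.
Qed.

(** Since ln 2 > 1/2; this absorbs the terms without a logarithm. *)
Lemma half_le_ln (t : R) : 2 <= t -> 1 <= 2 * ln t.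
Proof.
move=> t2; have : ln 2 <= ln t.
  by case: t2 => [h|<-]; [apply: Rlt_le; apply: ln_increasing; lra | lra].
by have := ln_lt_2; lra.
Qed.

Lemma Rsum_le_sqrt (f : nat -> nat) (n t N : nat) :
    (0 < n)%N -> (2 <= t)%N -> (forall i, (f i <= 2 * t)%N) ->
    (\sum_(0 <= i < N) i.+1 * f i ^ 2 <= 2 * t * n)%N ->
  Rsum (fun i => INR (f i)) N <= 11 * sqrt (INR n * INR t * ln (INR t)).
Proof.
move=> n0 t2 ft fs.
set n' := INR n; set t' := INR t; set L := ln t'.
have n'0 : 1 <= n' by apply: (le_INR 1); apply/leP.
have t'2 : 2 <= t' by apply: (le_INR 2); apply/leP.
have L1 : 1 <= 2 * L := half_le_ln t'2.
have nt : 0 < n' * t' by apply: Rmult_lt_0_compat; lra.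
set Q := sqrt _; pose S := sqrt (n' * t').
have SS : S * S = n' * t' by apply: sqrt_sqrt; lra.
have S0 : 0 < S by apply: sqrt_lt_R0.
have QQ : Q * Q = S * S * L by rewrite SS; apply: sqrt_sqrt; apply: Rmult_le_pos; lra.
have Q0 : 0 < Q by apply: sqrt_lt_R0; apply: Rmult_lt_0_compat; lra.
have SQ : S <= 2 * Q.
  apply: Rsqr_incr_0_var; last lra.
  rewrite /Rsqr; have -> : 2 * Q * (2 * Q) = 4 * (Q * Q) by ring.
  by rewrite QQ; have := Rmult_lt_0_compat _ _ S0 S0; nra.
pose W i := INR i.+1 * (INR (f i) * INR (f i)).
have WN : Rsum W N <= 2 * (S * S).
  have -> : Rsum W N = INR (\sum_(0 <= i < N) i.+1 * f i ^ 2)%N.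
    rewrite INR_sum; congr foldr; apply: eq_map => i.
    by rewrite /W -mulnn -multE !mult_INR.
  move/leP/le_INR: fs; rewrite -!multE !mult_INR SS -/t' -/n' /=; lra.
pose A i := if Rle_dec (INR i.+1 * INR i.+1 * t') n' then t' else 0.
pose D i := if Rle_dec (INR i.+1 * INR i.+1 * t') n' then 0 else
            if Rle_dec (INR i.+1 * INR i.+1) (n' * t') then / INR i.+1 else 0.
have AN : Rsum A N <= S by apply: Rsum_head_le; lra.
have DN : Rsum D N <= 1 + L by apply: Rsum_harmonic_le; lra.
(* The [A] term serves the head, [/ S * W i] the tail, and the last two terms the middle range. All
   are nonnegative, so they may be added in every row. *)
have P i : INR (f i) <= 2 * A i + (/ S * W i + (Q / (S * S) * W i + S * S / (4 * Q) * D i)).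
  have p1 : 1 <= INR i.+1 by rewrite S_INR; have := pos_INR i; lra.
  have x0 : 0 <= INR (f i) := pos_INR _.
  (* Integrality gives f <= f^2, used in the tail, where the weight [i.+1] is at least S. *)
  have xx : INR (f i) <= INR (f i) * INR (f i).
    by case: (f i) => [|m]; [rewrite /=; lra | rewrite S_INR; have := pos_INR m; nra].
  have xt : INR (f i) <= 2 * t' by have /leP/le_INR := ft i; rewrite -multE mult_INR.
  have W0 : 0 <= W i by apply: Rmult_le_pos; nra.
  have iS : 0 < / S by apply: Rinv_0_lt_compat.
  have iSS : 0 < Q / (S * S) by apply: Rdiv_lt_0_compat; nra.
  have iQ : 0 < S * S / (4 * Q) by apply: Rdiv_lt_0_compat; nra.
  have g1 : 0 <= / S * W i by apply: Rmult_le_pos; lra.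
  have g2 : 0 <= Q / (S * S) * W i by apply: Rmult_le_pos; lra.
  rewrite /A /D; case: Rle_dec => h1; rewrite /is_left; first lra.
  case: Rle_dec => h2; rewrite /is_left.
    (* AM-GM as a completed square; the weight Q / S^2 makes both resulting sums of order Q. *)
    have -> : Q / (S * S) * W i + S * S / (4 * Q) * / INR i.+1 =
      INR (f i) + Q / (S * S) * INR i.+1 * Rsqr (INR (f i) - S * S / (2 * Q * INR i.+1)).
      by rewrite /W /Rsqr; field; lra.
    have : 0 <= Q / (S * S) * INR i.+1 * Rsqr (INR (f i) - S * S / (2 * Q * INR i.+1)).
      by apply: Rmult_le_pos (Rle_0_sqr _); nra.
    lra.
  have iS' : S <= INR i.+1 by apply: Rsqr_incr_0_var; rewrite /Rsqr; lra.
  have : INR (f i) <= / S * W i; last lra.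
  apply: (Rmult_le_reg_l S) => //.
  have -> : S * (/ S * W i) = W i by field; lra.
  by rewrite /W; apply: Rmult_le_compat; lra.
apply: (Rle_trans _ _ _ (Rsum_le N P)).
rewrite !Rsum_add !Rsum_scal.
have b1 : / S * Rsum W N <= 2 * S.
  have -> : 2 * S = / S * (2 * (S * S)) by field; lra.
  by apply: Rmult_le_compat_l WN; apply: Rlt_le; apply: Rinv_0_lt_compat.
have b2 : Q / (S * S) * Rsum W N <= 2 * Q.
  have -> : 2 * Q = Q / (S * S) * (2 * (S * S)) by field; lra.
  by apply: Rmult_le_compat_l WN; apply: Rlt_le; apply: Rdiv_lt_0_compat; nra.
have b3 : S * S / (4 * Q) * Rsum D N <= Q.
  have -> : S * S / (4 * Q) = Q / (4 * L).
    have -> : S * S = Q * Q / L by rewrite QQ; field; lra.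
    by field; lra.
  have E : Q = Q / (4 * L) * (4 * L) by field; lra.
  rewrite [X in _ <= X]E; apply: Rmult_le_compat_l; last lra.
  by apply: Rlt_le; apply: Rdiv_lt_0_compat; lra.
(* Head and tail give 2S each and the middle range 2Q + Q; with S <= 2Q the total is 11 Q. *)
lra.
Qed.

(** * The bound on the distance of shapes *)

Lemma Rabs_INR_sub (a b : nat) : Rabs (INR a - INR b) = INR (a - b) + INR (b - a).
Proof.
case/orP: (leq_total a b) => h.
- have := h; rewrite -subn_eq0 => /eqP ->; rewrite minus_INR; last exact/leP.
  by rewrite Rabs_left1 /=; have /leP/le_INR := h; lra.
- have := h; rewrite -subn_eq0 => /eqP ->; rewrite minus_INR; last exact/leP.
  by rewrite Rabs_right /=; have /leP/le_INR := h; lra.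
Qed.

Lemma Delta_shapeE n la mu : Delta_shape n la mu =
  / 2 * (Rsum (fun i => INR (nth 0%N la i - nth 0%N mu i)) n +
         Rsum (fun i => INR (nth 0%N mu i - nth 0%N la i)) n).
Proof.
rewrite /Delta_shape -Rsum_add; congr (_ * foldr _ _ _).
by apply: eq_map => i; exact: Rabs_INR_sub.
Qed.

(** The one-sided estimate holds for both orders of the two shapes, and the factor 1/2 in
    [Delta_shape] restores the constant 11. *)
Lemma Delta_rsk_shape_le n t (p q : 'S_n) :
    (0 < n)%N -> (2 <= t)%N -> reach_in t p q ->
  Delta_shape n (rsk_shape p) (rsk_shape q) <= 11 * sqrt (INR n * INR t * ln (INR t)).
Proof.
move=> n0 t2 pq; rewrite Delta_shapeE.
have R1 k := proj1 (row_sum_reach k pq); have R2 k := proj2 (row_sum_reach k pq).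
have B1 := Rsum_le_sqrt (N := n) n0 t2 (row_sub_le R1 R2).
have B2 := Rsum_le_sqrt (N := n) n0 t2 (row_sub_le R2 R1).
have S1 := shape_weighted_sum_sqr_le n R1 R2 (rsk_shape_sorted p) (rsk_shape_sorted q).
have S2 := shape_weighted_sum_sqr_le n R2 R1 (rsk_shape_sorted q) (rsk_shape_sorted p).
rewrite sumn_rsk_shape in S1; rewrite sumn_rsk_shape in S2.
by have := B1 S1; have := B2 S2; lra.
Qed.

Close Scope R_scope.

Theorem theorem6 :
  exists C : R, Rlt R0 C /\
    forall (n t : nat) (p q : 'S_n),
      (0 < n)%N -> (2 <= t)%N -> perm_dist_is p q t ->
      Rle (Delta_shape n (rsk_shape p) (rsk_shape q))
          (Rmult C (sqrt (Rmult (Rmult (INR n) (INR t)) (ln (INR t))))).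
Proof.
exists (IZR 11); split; first lra.
by move=> n t p q n0 t2 [pq _]; exact: Delta_rsk_shape_le.
Qed.
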